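(* Let $A$ be a skew brace. For any $n\geq 1$, we have $$\mathrm{Ann}_n(A)\subseteq M_{W_n}(A),\qquad W_n=\{[x_1,x_2,\dots,x_{n+1}],\ [x_1,x_2,\dots,x_{n+1}]_\circ,\ x_1*x_2*\cdots*x_{n+1}\},$$ where all three words are right-normed.
   Context: A skew (left) brace is a set $A=(A,\cdot,\circ)$ with two group operations such that $a\circ(b\cdot c)=(a\circ b)\cdot a^{-1}\cdot(a\circ c)$ for all $a,b,c\in A$, where $a^{-1}$ is the inverse of $a$ in $(A,\cdot)$ and $\overline{a}$ is its inverse in $(A,\circ)$; the two groups share the identity $1$. For $a\in A$, $\lambda_a\in\mathrm{Aut}(A,\cdot)$ is $\lambda_a(b)=a^{-1}\cdot(a\circ b)$. Write $[a,b]=a\cdot b\cdot a^{-1}\cdot b^{-1}$, $[a,b]_\circ=a\circ b\circ\overline{a}\circ\overline{b}$, and $a*b=a^{-1}\cdot(a\circ b)\cdot b^{-1}$. The right-normed words are defined recursively for $m\ge3$ by $[x_1,x_2,\dots,x_m]=[x_1,[x_2,\dots,x_m]]$, $[x_1,x_2,\dots,x_m]_\circ=[x_1,[x_2,\dots,x_m]_\circ]_\circ$, and $x_1*x_2*\cdots*x_m=x_1*(x_2*\cdots*x_m)$. An ideal of $A$ is a normal subgroup of both $(A,\cdot)$ and $(A,\circ)$ that is invariant under all $\lambda_a$. The annihilator $\mathrm{Ann}(A)=\{z\in A:[a,z]=[a,z]_\circ=z*a=1\text{ for all }a\in A\}$ is an ideal of $A$. The annihilator series is the series of ideals defined by $\mathrm{Ann}_0(A)=1$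 and $\mathrm{Ann}_{n+1}(A)/\mathrm{Ann}_n(A)=\mathrm{Ann}(A/\mathrm{Ann}_n(A))$ for $n\ge0$. For a collection $W$ of skew brace words in $m$ variables (expressions in $x_1,\dots,x_m$ formed using the operations and inverses of $\cdot$ and $\circ$, evaluated in $A$ in the obvious way), the marginal left ideal $M_W(A)$ is the set of all $z\in A$ such that $$w(a_1,\dots,a_m)=w(a_1,\dots,a_i\cdot\lambda_b(z),\dots,a_m)=w(a_1,\dots,\lambda_b(z)\cdot a_i,\dots,a_m)$$ $$=w(a_1,\dots,a_i\circ\lambda_b(z),\dots,a_m)=w(a_1,\dots,\lambda_b(z)\circ a_i,\dots,a_m)$$ for all $w\in W$, all $b,a_1,\dots,a_m\in A$ and all $1\le i\le m$; it is a left ideal of $A$ (a subgroup of $(A,\cdot)$ invariant under all $\lambda_b$). *)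

(* Defs.v *)
From HB Require Import structures.
From mathcomp Require Import all_boot.
From mathcomp Require Import boolp classical_sets.

Set Implicit Arguments.
Unset Strict Implicit.
Unset Printing Implicit Defensive.

Declare Scope skew_brace_scope.
Delimit Scope skew_brace_scope with SB.
Local Open Scope quotient_scope.
Local Open Scope classical_set_scope.
Local Open Scope group_scope.
Local Open Scope skew_brace_scope.

(* The circle group comes with its own neutral element [cone]; that it is
   equal to 1 is the lemma [cone1] below. *)
HB.mixin Record Group_isSkewBrace A of Group A := {
  circ : A -> A -> A;
  cinv : A -> A;
  cone : A;
  circA : associative circ;
  circ_onel : left_id cone circ;
  circ_oner : right_id cone circ;
  circVl : left_inverse cone cinv circ;
  circVr : right_inverse cone cinv circ;
  circMr : forall a b c : A, circ a (b * c) = circ a b * a^-1 * circ a c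
}.

#[short(type="skewBraceType")]
HB.structure Definition SkewBrace := {A of Group_isSkewBrace A & Group A}.

Notation "a ⊚ b" := (circ a b)
  (at level 40, left associativity) : skew_brace_scope.

Section Operations.
Variable A : skewBraceType.
Implicit Types a b : A.

Definition lam a b : A := a^-1 * (a ⊚ b).

(* Not the library's [~ a, b], which is a^-1 * b^-1 * a * b. *)
Definition comm a b : A := a * b * a^-1 * b^-1.

Definition ccomm a b : A := a ⊚ b ⊚ cinv a ⊚ cinv b.

Definition star a b : A := a^-1 * (a ⊚ b) * b^-1.

End Operations.

Section Ideals.

Definition normal_subgroup (T : Type) (op : T -> T -> T) (inv : T -> T)
    (e : T) (I : set T) : Prop :=
  [/\ I e,
      forall x y, I x -> I y -> I (op x y),
      forall x, I x -> I (inv x)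
    & forall a x, I x -> I (op (op a x) (inv a))].

Definition is_ideal (A : skewBraceType) (I : set A) : Prop :=
  [/\ normal_subgroup (fun x y : A => x * y) (fun x : A => x^-1) 1 I,
      normal_subgroup (@circ A) (@cinv A) (@cone A) I
    & forall a x, I x -> I (lam a x)].

Record ideal (A : skewBraceType) := Ideal {
  ideal_set :> set A;
  idealP : is_ideal ideal_set
}.

End Ideals.

Section BasicTheory.
Variable A : skewBraceType.
Implicit Types a b c x y : A.

Lemma cone1 : @cone A = 1.
Proof.
have := circMr (@cone A) 1 1.
rewrite mulg1 !circ_onel mul1g mulg1 => /(congr1 (fun x => x^-1)).
by rewrite invgK invg1.
Qed.

Lemma circ1a a : 1 ⊚ a = a. Proof. by rewrite -cone1 circ_onel. Qed.
Lemma circa1 a : a ⊚ 1 = a. Proof. by rewrite -cone1 circ_oner. Qed.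
Lemma cinvKl a : cinv a ⊚ a = 1. Proof. by rewrite circVl cone1. Qed.
Lemma cinvKr a : a ⊚ cinv a = 1. Proof. by rewrite circVr cone1. Qed.
Lemma circKl a b : cinv a ⊚ (a ⊚ b) = b.
Proof. by rewrite circA cinvKl circ1a. Qed.
Lemma circKVl a b : a ⊚ (cinv a ⊚ b) = b.
Proof. by rewrite circA cinvKr circ1a. Qed.
Lemma circKr a b : b ⊚ a ⊚ cinv a = b.
Proof. by rewrite -circA cinvKr circa1. Qed.
Lemma circKVr a b : b ⊚ cinv a ⊚ a = b.
Proof. by rewrite -circA cinvKl circa1. Qed.

Lemma circI a b c : a ⊚ b = a ⊚ c -> b = c.
Proof. by move=> /(congr1 (circ (cinv a))); rewrite !circKl. Qed.

Lemma cinv_uniq a b : a ⊚ b = 1 -> cinv a = b.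
Proof. by move=> ab; apply: (@circI a); rewrite ab cinvKr. Qed.

Lemma cinvK a : cinv (cinv a) = a.
Proof. exact/cinv_uniq/cinvKl. Qed.

Lemma cinvM a b : cinv (a ⊚ b) = cinv b ⊚ cinv a.
Proof. by apply: cinv_uniq; rewrite circA circKr cinvKr. Qed.

Lemma circE a b : a ⊚ b = a * lam a b.
Proof. by rewrite /lam mulgA mulgV mul1g. Qed.

Lemma lam_circ a b c : lam (a ⊚ b) c = lam a (lam b c).
Proof.
have e : a ⊚ (b * lam b c) = a ⊚ b * lam a (lam b c).
  by rewrite circMr /lam !mulgA.
rewrite -circE circA in e.
by rewrite {1}/lam e mulgA mulVg mul1g.
Qed.

Lemma lam1 a : lam 1 a = a.
Proof. by rewrite /lam circ1a invg1 mul1g. Qed.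

Lemma mulE a b : a * b = a ⊚ lam (cinv a) b.
Proof. by rewrite circE -lam_circ cinvKr lam1. Qed.

End BasicTheory.

Section Quotient.
Variables (A : skewBraceType) (I : ideal A).
Implicit Types a b c d x y : A.

Let i1 : ideal_set I 1. Proof. by case: (idealP I) => -[]. Qed.
Let iM x y : ideal_set I x -> ideal_set I y -> ideal_set I (x * y).
Proof. by case: (idealP I) => -[_ h _ _] _ _; apply: h. Qed.
Let iV x : ideal_set I x -> ideal_set I x^-1.
Proof. by case: (idealP I) => -[_ _ h _] _ _; apply: h. Qed.
Let iJ a x : ideal_set I x -> ideal_set I (a * x * a^-1).
Proof. by case: (idealP I) => -[_ _ _ h] _ _; apply: h. Qed.
Let iC x y : ideal_set I x -> ideal_set I y -> ideal_set I (x ⊚ y).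
Proof. by case: (idealP I) => _ [_ h _ _] _; apply: h. Qed.
Let iCV x : ideal_set I x -> ideal_set I (cinv x).
Proof. by case: (idealP I) => _ [_ _ h _] _; apply: h. Qed.
Let iCJ a x : ideal_set I x -> ideal_set I (a ⊚ x ⊚ cinv a).
Proof. by case: (idealP I) => _ [_ _ _ h] _; apply: h. Qed.
Let iL a x : ideal_set I x -> ideal_set I (lam a x).
Proof. by case: (idealP I) => _ _; apply. Qed.

Definition ideal_rel : rel A := fun a b => `[< ideal_set I (a^-1 * b) >].

Lemma ideal_rel_refl : reflexive ideal_rel.
Proof. by move=> a; apply/asboolP; rewrite mulVg. Qed.

Lemma ideal_rel_sym : symmetric ideal_rel.
Proof.
have s a b : ideal_rel a b -> ideal_rel b a.
  by move=> /asboolP/iV; rewrite invgM invgK => ?; apply/asboolP.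
by move=> a b; apply/idP/idP; apply: s.
Qed.

Lemma ideal_rel_trans : transitive ideal_rel.
Proof.
move=> b a c /asboolP ab /asboolP bc; apply/asboolP.
by have := iM ab bc; rewrite mulgA -[_ * b^-1]mulgA mulgV mulg1.
Qed.

Canonical ideal_equiv :=
  EquivRel ideal_rel ideal_rel_refl ideal_rel_sym ideal_rel_trans.

Definition brace_quot : Type := {eq_quot ideal_equiv}.
HB.instance Definition _ := Choice.on brace_quot.
HB.instance Definition _ := EqQuotient.on brace_quot.
Local Notation Q := brace_quot.

Lemma eq_quotP a b : \pi_Q a = \pi_Q b <-> ideal_set I (a^-1 * b).
Proof.
by split=> [/eqmodP/asboolP//|h]; apply/eqmodP/asboolP.
Qed.

Lemma eq_quot_circP a b : \pi_Q a = \pi_Q b <-> ideal_set I (cinv a ⊚ b).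
Proof.
rewrite eq_quotP; split=> h.
- have -> : b = a ⊚ lam (cinv a) (a^-1 * b) by rewrite -mulE mulgA mulgV mul1g.
  by rewrite circKl; apply: iL.
- have -> : b = a * lam a (cinv a ⊚ b) by rewrite -circE circKVl.
  by rewrite mulgA mulVg mul1g; apply: iL.
Qed.

Definition qmul : Q -> Q -> Q := lift_op2 Q (fun a b => a * b).
Definition qinv : Q -> Q := lift_op1 Q (fun a => a^-1).
Definition qone : Q := lift_cst Q 1.
Definition qcirc : Q -> Q -> Q := lift_op2 Q (@circ A).
Definition qcinv : Q -> Q := lift_op1 Q (@cinv A).
Definition qcone : Q := lift_cst Q (@cone A).

Lemma pi_qmul : {morph \pi_Q : a b / a * b >-> qmul a b}.
Proof.
move=> a b; unlock qmul; apply/eq_quotP.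
set a' := repr _; set b' := repr _.
have /eq_quotP ha : \pi_Q a = \pi_Q a' by rewrite reprK.
have /eq_quotP hb : \pi_Q b = \pi_Q b' by rewrite reprK.
have -> : (a * b)^-1 * (a' * b')
    = (b^-1 * (a^-1 * a') * b^-1^-1) * (b^-1 * b').
  by rewrite invgK invgM !mulgA mulgK.
by apply: iM => //; apply: iJ.
Qed.

Lemma pi_qinv : {morph \pi_Q : a / a^-1 >-> qinv a}.
Proof.
move=> a; unlock qinv; apply/eq_quotP.
set a' := repr _.
have /eq_quotP ha : \pi_Q a = \pi_Q a' by rewrite reprK.
have := iJ a' (iV ha).
by rewrite invgM !invgK !mulgA mulgV mul1g.
Qed.

Lemma pi_qone : \pi_Q 1 = qone.
Proof. by unlock qone. Qed.

Lemma pi_qcirc : {morph \pi_Q : a b / a ⊚ b >-> qcirc a b}.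
Proof.
move=> a b; unlock qcirc; apply/eq_quot_circP.
set a' := repr _; set b' := repr _.
have /eq_quot_circP ha : \pi_Q a = \pi_Q a' by rewrite reprK.
have /eq_quot_circP hb : \pi_Q b = \pi_Q b' by rewrite reprK.
have -> : cinv (a ⊚ b) ⊚ (a' ⊚ b')
    = (cinv b ⊚ (cinv a ⊚ a') ⊚ cinv (cinv b)) ⊚ (cinv b ⊚ b').
  by rewrite cinvK cinvM !circA circKr.
by apply: iC => //; apply: iCJ.
Qed.

Lemma pi_qcinv : {morph \pi_Q : a / cinv a >-> qcinv a}.
Proof.
move=> a; unlock qcinv; apply/eq_quot_circP.
set a' := repr _.
have /eq_quot_circP ha : \pi_Q a = \pi_Q a' by rewrite reprK.
have := iCJ a' (iCV ha).
by rewrite cinvM !cinvK !circA cinvKr circ1a.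
Qed.

Lemma pi_qcone : \pi_Q (@cone A) = qcone.
Proof. by unlock qcone. Qed.

Lemma qmulA : associative qmul.
Proof.
by elim/quotW=> a; elim/quotW=> b; elim/quotW=> c; rewrite -!pi_qmul mulgA.
Qed.
Lemma qmul1 : left_id qone qmul.
Proof. by elim/quotW=> a; rewrite -pi_qone -pi_qmul mul1g. Qed.
Lemma qmulr1 : right_id qone qmul.
Proof. by elim/quotW=> a; rewrite -pi_qone -pi_qmul mulg1. Qed.
Lemma qmulV : left_inverse qone qinv qmul.
Proof. by elim/quotW=> a; rewrite -pi_qone -pi_qinv -pi_qmul mulVg. Qed.
Lemma qmulrV : right_inverse qone qinv qmul.
Proof. by elim/quotW=> a; rewrite -pi_qone -pi_qinv -pi_qmul mulgV. Qed.

HB.instance Definition _ :=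
  isGroup.Build brace_quot qmulA qmul1 qmulr1 qmulV qmulrV.

Lemma qcircA : associative qcirc.
Proof.
by elim/quotW=> a; elim/quotW=> b; elim/quotW=> c; rewrite -!pi_qcirc circA.
Qed.
Lemma qcirc1 : left_id qcone qcirc.
Proof. by elim/quotW=> a; rewrite -pi_qcone -pi_qcirc circ_onel. Qed.
Lemma qcircr1 : right_id qcone qcirc.
Proof. by elim/quotW=> a; rewrite -pi_qcone -pi_qcirc circ_oner. Qed.
Lemma qcircV : left_inverse qcone qcinv qcirc.
Proof. by elim/quotW=> a; rewrite -pi_qcone -pi_qcinv -pi_qcirc circVl. Qed.
Lemma qcircrV : right_inverse qcone qcinv qcirc.
Proof. by elim/quotW=> a; rewrite -pi_qcone -pi_qcinv -pi_qcirc circVr. Qed.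
Lemma qcircMr (a b c : brace_quot) :
  qcirc a (b * c) = qcirc a b * a^-1 * qcirc a c.
Proof.
rewrite -[a]reprK -[b]reprK -[c]reprK.
rewrite -[_ * _]pi_qmul -!pi_qcirc -[_^-1]pi_qinv circMr.
by rewrite !pi_qmul.
Qed.

HB.instance Definition _ :=
  Group_isSkewBrace.Build brace_quot qcircA qcirc1 qcircr1 qcircV qcircrV
    qcircMr.

Definition brace_pi (a : A) : brace_quot := \pi_Q a.

Lemma brace_pi1 : brace_pi 1 = 1. Proof. exact: pi_qone. Qed.
Lemma brace_piM : {morph brace_pi : a b / a * b}. Proof. exact: pi_qmul. Qed.
Lemma brace_piV : {morph brace_pi : a / a^-1}. Proof. exact: pi_qinv. Qed.
Lemma brace_pi_circ : {morph brace_pi : a b / a ⊚ b}.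
Proof. exact: pi_qcirc. Qed.
Lemma brace_pi_cinv : {morph brace_pi : a / cinv a}.
Proof. exact: pi_qcinv. Qed.
Lemma brace_pi_cone : brace_pi (@cone A) = cone. Proof. exact: pi_qcone. Qed.
Lemma brace_pi_lam : {morph brace_pi : a b / lam a b}.
Proof. by move=> a b; rewrite brace_piM brace_piV brace_pi_circ. Qed.

Lemma brace_pi_eq1 a : brace_pi a = 1 <-> ideal_set I a.
Proof.
rewrite -brace_pi1; split=> [/esym/eq_quotP|h]; first by rewrite invg1 mul1g.
by apply/esym/eq_quotP; rewrite invg1 mul1g.
Qed.

Lemma brace_pi_surj (q : brace_quot) : exists a, brace_pi a = q.
Proof. by exists (repr q); rewrite /brace_pi reprK. Qed.

Lemma preim_is_ideal (J : ideal brace_quot) : is_ideal (brace_pi @^-1` J).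
Proof.
case: (idealP J) => -[h1 h2 h3 h4] [k1 k2 k3 k4] l.
split; first split.
- by rewrite /preimage /= brace_pi1.
- by move=> x y jx jy; rewrite /preimage /= brace_piM; apply: h2.
- by move=> x jx; rewrite /preimage /= brace_piV; apply: h3.
- by move=> a x jx; rewrite /preimage /= !brace_piM brace_piV; apply: h4.
- split.
  + by rewrite /preimage /= brace_pi_cone.
  + by move=> x y jx jy; rewrite /preimage /= brace_pi_circ; apply: k2.
  + by move=> x jx; rewrite /preimage /= brace_pi_cinv; apply: k3.
  + move=> a x jx; rewrite /preimage /= !brace_pi_circ brace_pi_cinv.
    exact: k4.
- by move=> a x jx; rewrite /preimage /= brace_pi_lam; apply: l.
Qed.

Definition preim_ideal (J : ideal brace_quot) : ideal A :=
  Ideal (preim_is_ideal J).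

End Quotient.

Section Annihilator.
Variable A : skewBraceType.
Implicit Types a z : A.

Definition Ann : set A :=
  [set z | forall a, [/\ comm a z = 1, ccomm a z = 1 & star z a = 1]].

Lemma AnnP z : Ann z <->
  forall a, [/\ a * z = z * a, a ⊚ z = z ⊚ a & z ⊚ a = z * a].
Proof.
split=> h a; have [h1 h2 h3] := h a; split.
- by have /divg1_eq e := h1; rewrite -{2}e mulgVK.
- have /(congr1 (fun x => x ⊚ z ⊚ a)) := h2.
  by rewrite /ccomm !circKVr circ1a.
- by have /divg1_eq e := h3; rewrite -{2}e mulVKg.
- by rewrite /comm h1 mulgK mulgV.
- by rewrite /ccomm h2 circKr cinvKr.
- by rewrite /star h3 mulKg mulgV.
Qed.

Lemma Ann_is_ideal : is_ideal Ann.
Proof.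
have A1 : Ann 1 by apply/AnnP => a; rewrite mulg1 mul1g circa1 circ1a.
have M z w : Ann z -> Ann w -> Ann (z * w).
  move=> /AnnP hz /AnnP hw.
  have zw : z ⊚ w = z * w by case: (hz w).
  apply/AnnP => a.
  have [z1 z2 z3] := hz a; have [w1 w2 w3] := hw a.
  have [_ _ z4] := hz (w * a).
  split; first by rewrite mulgA z1 -mulgA w1 mulgA.
    by rewrite -zw circA z2 -!circA w2.
  by rewrite -zw -circA w3 z4 zw mulgA.
have VE z : Ann z -> cinv z = z^-1.
  by move=> /AnnP hz; apply: cinv_uniq; case: (hz z^-1) => _ _ ->; rewrite mulgV.
have V z : Ann z -> Ann z^-1.
  move=> Az; have /AnnP hz := Az; apply/AnnP => a.
  have [z1 z2 z3] := hz a; split.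
  - by apply: (mulgI z); rewrite mulgA -z1 mulgK mulVKg.
  - rewrite -VE //; apply: (@circI _ z).
    by rewrite circA -z2 circKr circKVl.
  - rewrite -VE //; apply: (@circI _ z); rewrite circKVl.
    by have [_ _ ->] := hz (cinv z * a); rewrite VE // mulVKg.
split; first split=> //.
- by move=> a z Az; have /AnnP/(_ a)[-> _ _] := Az; rewrite mulgK.
- split.
  + by rewrite cone1.
  + move=> z w Az Aw; have /AnnP/(_ w)[_ _ ->] := Az; exact: M.
  + by move=> z Az; rewrite VE //; apply: V.
  + by move=> a z Az; have /AnnP/(_ a)[_ -> _] := Az; rewrite circKr.
- move=> a z Az; have /AnnP/(_ a)[z1 z2 z3] := Az.
  by rewrite /lam z2 z3 -z1 mulKg.
Qed.

Definition Ann_ideal : ideal A := Ideal Ann_is_ideal.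

Lemma trivial_is_ideal : is_ideal [set (1 : A)].
Proof.
split; first split=> //=.
- by move=> x y -> ->; rewrite mulg1.
- by move=> x ->; rewrite invg1.
- by move=> a x ->; rewrite mulg1 mulgV.
- split=> /=; first exact: cone1.
  + by move=> x y -> ->; rewrite circ1a.
  + by move=> x ->; apply: cinv_uniq; rewrite circ1a.
  + by move=> a x ->; rewrite circa1 cinvKr.
- by move=> a x /= ->; rewrite /lam circa1 mulVg.
Qed.

Definition trivial_ideal : ideal A := Ideal trivial_is_ideal.

End Annihilator.
Arguments Ann A : clear implicits.

(* Ann_{n+1}(A) is the full preimage of Ann(A / Ann_n(A)) under the projection
   A -> A / Ann_n(A). *)
Fixpoint Ann_series (A : skewBraceType) (n : nat) : ideal A :=
  if n is n'.+1 then preim_ideal (Ann_ideal (brace_quot (Ann_series A n')))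
  else trivial_ideal A.

Inductive word (m : nat) : Type :=
| WVar of 'I_m
| WMul of word m & word m
| WInv of word m
| WCirc of word m & word m
| WCinv of word m.

Section Words.
Variable m : nat.
Implicit Types u v : word m.

Definition wcomm u v : word m :=
  WMul (WMul (WMul u v) (WInv u)) (WInv v).

Definition wccomm u v : word m :=
  WCirc (WCirc (WCirc u v) (WCinv u)) (WCinv v).

Definition wstar u v : word m :=
  WMul (WMul (WInv u) (WCirc u v)) (WInv v).

Fixpoint weval (A : skewBraceType) (a : 'I_m -> A) (w : word m) : A :=
  match w with
  | WVar i => a i
  | WMul u v => weval a u * weval a v
  | WInv u => (weval a u)^-1
  | WCirc u v => weval a u ⊚ weval a v
  | WCinv u => cinv (weval a u)
  end.

Definition marginal (A : skewBraceType) (W : set (word m)) : set A :=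
  [set z | forall w : word m, W w ->
     forall (b : A) (a : 'I_m -> A) (i : 'I_m),
     [/\ weval a w = weval [eta a with i |-> a i * lam b z] w,
         weval a w = weval [eta a with i |-> lam b z * a i] w,
         weval a w = weval [eta a with i |-> a i ⊚ lam b z] w
       & weval a w = weval [eta a with i |-> lam b z ⊚ a i] w]].

End Words.
Arguments marginal {m} A W.

(* right_normed op x [:: y; ..; z] = op x (op y (.. z)) *)
Fixpoint right_normed (T : Type) (op : T -> T -> T) (x : T) (s : seq T) : T :=
  if s is y :: s' then op x (right_normed op y s') else x.

(* The right-normed word in the n+1 variables x_1, ..., x_{n+1}, numbered from
   0 to n in 'I_n.+1. *)
Definition right_normed_word (n : nat)
    (op : word n.+1 -> word n.+1 -> word n.+1) : word n.+1 :=
  right_normed op (WVar ord0) [seq WVar (lift ord0 i) | i <- enum 'I_n].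

Definition W_ (n : nat) : set (word n.+1) :=
  [set right_normed_word (@wcomm n.+1);
       right_normed_word (@wccomm n.+1);
       right_normed_word (@wstar n.+1)].
Arguments W_ n : clear implicits.

(* Main.v *)
From HB Require Import structures.
From Corelib Require Import Setoid Morphisms.
Require Import Defs.
From mathcomp Require Import all_boot.
From mathcomp Require Import classical_sets.

(** The words [x, y], [x, y]_∘ and x * y all have the form act(x, y) y^-1,
    where a group G acts by automorphisms on a group H: conjugation in (A, ·),
    conjugation in (A, ∘), and the action lambda of (A, ∘) on (A, ·).  So all
    three cases follow from one statement on right-normed brackets of a group
    action, in the presence of congruences on G and H, indexed by k (here:
    being equal modulo Ann_k), such that passing from level k+1 to level k
    makes classes of 1 central, fixed by G and acting trivially.

    Write w for the bracket of x_1, ..., x_j in G and y in H.  The key fact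
    [act_bracket] is an analogue of [Z_{j+1}(G), gamma_{j+1}(G)] = 1: an
    element z of G that is 1 at level j+1+i satisfies act(z, w) = w at level i.
    Its proof is the computation behind the three subgroups lemma.  From it,
    [bracket_congr] follows by induction on j: when all entries change within
    their classes at level j+i, the value of w does not change at level i.  In
    a bracket of x with w, the change of w costs one level by centrality, while
    the change of x has no effect at level i by the key fact.  Taking i = 0 and
    j = n gives the theorem, as multiplying an entry on either side, by either
    operation, by an element of the ideal Ann_n is a change modulo Ann_n. *)

Set Implicit Arguments.
Unset Strict Implicit.
Unset Printing Implicit Defensive.

Local Open Scope group_scope.
Local Open Scope skew_brace_scope.

(** The hypotheses are on congruences rather than on a central series of
    subgroups because equality modulo Ann_k is the same relation for both
    groups of a skew brace, whereas the cosets have two descriptions. *)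
Record central_congruences (G : groupType) (E : nat -> relation G) : Prop :=
  CentralCongruences {
    cc_equiv : forall k, Equivalence (E k);
    cc_mul : forall k, Proper (E k ==> E k ==> E k) (fun x y : G => x * y);
    cc_central : forall k z x, E k.+1 z 1 -> E k (z * x) (x * z)
  }.

Record central_action (G H : groupType) (act : G -> H -> H)
    (EG : nat -> relation G) (EH : nat -> relation H) : Prop :=
  CentralAction {
    actM : forall x y h, act (x * y) h = act x (act y h);
    act_mul : forall x h h', act x (h * h') = act x h * act x h';
    act_congr : forall k x, Proper (EH k ==> EH k) (act x);
    act_fix : forall k x s, EH k.+1 s 1 -> EH k (act x s) s;
    act_triv : forall k z h, EG k.+1 z 1 -> EH k (act z h) h
  }.

(* As classes, the two records let [rewrite] use congruences inside words. *)
Existing Class central_congruences.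
Existing Class central_action.
#[local] Existing Instances cc_equiv cc_mul act_congr.

Lemma conj_central_action (G : groupType) (E : nat -> relation G) :
  central_congruences E -> central_action (fun x y : G => x * y * x^-1) E E.
Proof.
case=> Eeq EM Ec; split=> [x y h | x h h' | k x h h' hh' | k x s s1 | k z h z1].
- by rewrite invgM !mulgA.
- by rewrite !mulgA mulgVK.
- by rewrite hh'; reflexivity.
- by rewrite -(Ec _ _ x s1) mulgK; reflexivity.
- by rewrite (Ec _ _ h z1) mulgK; reflexivity.
Qed.

Section Brackets.
Variables (G H : groupType) (act : G -> H -> H).
Variables (EG : nat -> relation G) (EH : nat -> relation H).
Hypotheses (ccG : central_congruences EG) (ccH : central_congruences EH).
Hypothesis cact : central_action act EG EH.

Definition bracket (x : G) (h : H) : H := act x h * h^-1.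

Lemma actV x h : act x h^-1 = (act x h)^-1.
Proof.
have act1 : act x 1 = 1.
  by apply: (mulgI (act x 1)); rewrite -(act_mul cact) !mulg1.
by apply: (mulgI (act x h)); rewrite -(act_mul cact) !mulgV.
Qed.

Lemma congr_div (K : groupType) (E : nat -> relation K) k (x y : K) :
  central_congruences E -> E k x y -> E k (x^-1 * y) 1 /\ E k (y * x^-1) 1.
Proof. by move=> cc xy; rewrite -xy mulVg mulgV; split; reflexivity. Qed.

(** If h' = s h, then s is fixed by x and central one level lower, so the two
    occurrences of s in act(x, s h) (s h)^-1 cancel. *)
Lemma bracket_congr_r k x h h' :
  EH k.+1 h h' -> EH k (bracket x h) (bracket x h').
Proof.
move=> hh'; have s1 := (congr_div ccH hh').2.
have -> : h' = h' * h^-1 * h by rewrite mulgVK.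
set s := h' * h^-1 in s1 *; clearbody s.
rewrite /bracket (act_mul cact) (act_fix cact x s1) invgM -mulgA.
by rewrite (cc_central ccH _ s1) -!mulgA mulVg mulg1; reflexivity.
Qed.

(** By induction on the bracket.  Write z x = x z u: the commutator u is 1 one
    level below z, which suffices for it to fix w.  So, at
    level k, z sends the bracket of x and w to the bracket of x and act(z, w).
    By induction again act(z, w) = w, now at level k+1, and [bracket_congr_r]
    applies. *)
Lemma act_bracket k z xs h :
  EG (size xs + k).+1 z 1 ->
  EH k (act z (foldr bracket h xs)) (foldr bracket h xs).
Proof.
elim: xs z k => [|x xs IH] z k /= z1; first exact: (act_triv cact).
set w := foldr bracket h xs in IH *.
pose u := (x * z)^-1 * (z * x).
have u1 : EG (size xs + k).+1 u 1.
  apply: (congr_div ccG _).1; symmetry; exact: (cc_central ccG).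
have zx : z * x = x * z * u by rewrite /u mulVKg.
(* Otherwise rewriting with [actM] would unfold u. *)
clearbody u; have uw : EH k (act u w) w := IH u k u1.
have zw : EH k.+1 (act z w) w by apply: IH; rewrite addnS.
rewrite {1}/bracket (act_mul cact) actV -(actM cact) zx !(actM cact) uw.
exact: bracket_congr_r zw.
Qed.

Lemma bracket_congr (I : Type) (a a' : I -> G) s (h h' : H) k :
  (forall i, EG (size s + k) (a i) (a' i)) -> EH (size s + k) h h' ->
  EH k (foldr bracket h (map a s)) (foldr bracket h' (map a' s)).
Proof.
elim: s k => [//|x s IH] k /= aa' hh'.
have ww' := IH k.+1; rewrite addnS in ww'; move/(_ aa' hh') in ww'.
rewrite (bracket_congr_r (a x) ww') /bracket.
set w' := foldr _ h' _.
pose z := (a x)^-1 * a' x.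
have z1 : EG (size s + k).+1 z 1 := (congr_div ccG (aa' x)).1.
have -> : a' x = a x * z by rewrite /z mulVKg.
rewrite (actM cact) [act z w']act_bracket ?size_map //; reflexivity.
Qed.

End Brackets.

(** A copy of the carrier of A, so that (A, ∘) can be a second canonical group
    structure next to (A, ·). *)
Definition circ_group (A : skewBraceType) : Type := A.

HB.instance Definition _ (A : skewBraceType) := Choice.on (circ_group A).
HB.instance Definition _ (A : skewBraceType) :=
  isGroup.Build (circ_group A) (@circA A) (@circ1a A) (@circa1 A)
    (@cinvKl A) (@cinvKr A).

Section AnnSeries.
Variable A : skewBraceType.

Definition ann_eq (k : nat) (x y : A) : Prop :=
  brace_pi (Ann_series A k) x = brace_pi (Ann_series A k) y.

Lemma ann_eq1P k x : ann_eq k x 1 <-> ideal_set (Ann_series A k) x.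
Proof. by rewrite /ann_eq brace_pi1; apply: brace_pi_eq1. Qed.

Lemma ann_eq0 x y : ann_eq 0 x y -> x = y.
Proof. by move=> /eq_quotP e; apply: (mulgI x^-1); rewrite e mulVg. Qed.

Lemma ann_eq_Ann k z : ann_eq k.+1 z 1 -> Ann _ (brace_pi (Ann_series A k) z).
Proof. by move=> /ann_eq1P. Qed.

Lemma ann_eq_equiv k : Equivalence (ann_eq k).
Proof. by split=> [x|x y|x y z xy yz] //; apply: etrans xy yz. Qed.

Lemma dot_congruences : @central_congruences A ann_eq.
Proof.
split=> [k|k x x' xx' y y' yy'|k z x /ann_eq_Ann /AnnP z1].
- exact: ann_eq_equiv.
- by rewrite /ann_eq !brace_piM xx' yy'.
- by rewrite /ann_eq !brace_piM; case: (z1 (brace_pi _ x)).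
Qed.

Lemma circ_congruences : @central_congruences (circ_group A) ann_eq.
Proof.
split=> [k|k x x' xx' y y' yy'|k z x /ann_eq_Ann /AnnP z1].
- exact: ann_eq_equiv.
- by rewrite /ann_eq !brace_pi_circ xx' yy'.
- by rewrite /ann_eq !brace_pi_circ; case: (z1 (brace_pi _ x)).
Qed.

Lemma lam_central_action :
  @central_action (circ_group A) A (@lam A) ann_eq ann_eq.
Proof.
split=> [x y h|x h h'|k x h h' hh'|k x s /ann_eq_Ann /AnnP s1|k z h].
- exact: lam_circ.
- by rewrite /lam circMr !mulgA.
- by rewrite /ann_eq !brace_pi_lam hh'.
- rewrite /ann_eq brace_pi_lam /lam.
  by have [xs -> ->] := s1 (brace_pi _ x); rewrite -xs mulKg.
- move=> /ann_eq_Ann /AnnP z1; rewrite /ann_eq brace_pi_lam /lam.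
  by have [_ _ ->] := z1 (brace_pi _ h); rewrite mulKg.
Qed.

Lemma ann_eq_ideal k z x : ideal_set (Ann_series A k) z ->
  [/\ ann_eq k x (x * z), ann_eq k x (z * x),
      ann_eq k x (x ⊚ z) & ann_eq k x (z ⊚ x)].
Proof.
move=> /brace_pi_eq1 z1.
by split; rewrite /ann_eq ?brace_piM ?brace_pi_circ z1
  ?mulg1 ?mul1g ?circa1 ?circ1a.
Qed.

End AnnSeries.

(** Singles out the last entry, the only one that never acts on another. *)
Lemma right_normed_foldr T (op : T -> T -> T) x s :
  right_normed op x s = foldr op (last x s) (belast x s).
Proof. by elim: s x => //= y s IH x; rewrite IH. Qed.

Lemma weval_right_normed_word (A : skewBraceType) n (op : A -> A -> A) wop
    (a : 'I_n.+1 -> A) :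
  (forall u v, weval a (wop u v) = op (weval a u) (weval a v)) ->
  let s := [seq lift ord0 i | i <- enum 'I_n] in
  weval a (right_normed_word wop)
  = foldr op (a (last ord0 s)) (map a (belast ord0 s)).
Proof.
move=> wopE s; rewrite /right_normed_word map_comp right_normed_foldr.
rewrite last_map belast_map -/s.
by elim: (belast _ _) => //= i r IH; rewrite wopE IH.
Qed.

(** The hypothesis on [op] is the conclusion of [bracket_congr] for k = 0.  It
    is stated on the carrier of A because for [star] the acting group and the
    group acted upon are different structures on that carrier. *)
Lemma weval_right_normed_congr (A : skewBraceType) n (op : A -> A -> A) wop
    (a a' : 'I_n.+1 -> A) :
  (forall b u v, weval b (wop u v) = op (weval b u) (weval b v)) ->
  (forall (I : Type) (b b' : I -> A) s h h',
     (forall i, ann_eq (size s + 0) (b i) (b' i)) ->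
     ann_eq (size s + 0) h h' ->
     ann_eq 0 (foldr op h (map b s)) (foldr op h' (map b' s))) ->
  (forall i, ann_eq n (a i) (a' i)) ->
  weval a (right_normed_word wop) = weval a' (right_normed_word wop).
Proof.
move=> wopE congr_op aa'; rewrite !(weval_right_normed_word (wopE _)).
by apply/ann_eq0/congr_op => [i|];
  rewrite size_belast size_map size_enum_ord addn0.
Qed.

Lemma weval_W_congr (A : skewBraceType) n w (a a' : 'I_n.+1 -> A) :
  W_ n w -> (forall i, ann_eq n (a i) (a' i)) -> weval a w = weval a' w.
Proof.
have dot := dot_congruences A; have circ := circ_congruences A.
have lamA := lam_central_action A.
case=> [[]|] -> aa'.
- apply: (@weval_right_normed_congr A n (@comm A)) aa' => // I b b' s h h'.
  exact: (bracket_congr dot dot (conj_central_action dot)).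
- apply: (@weval_right_normed_congr A n (@ccomm A)) aa' => // I b b' s h h'.
  exact: (bracket_congr circ circ (conj_central_action circ)).
- apply: (@weval_right_normed_congr A n (@star A)) aa' => // I b b' s h h'.
  exact: (bracket_congr circ dot lamA).
Qed.

Local Open Scope classical_set_scope.

Theorem proposition3p9 (A : skewBraceType) (n : nat) (hn : 1 <= n) :
  Ann_series A n `<=` marginal A (W_ n).
Proof.
move=> z Az w Ww b a i.
have [_ _ lamI] := idealP (Ann_series A n).
have [eMr eMl eCr eCl] := ann_eq_ideal (a i) (lamI b z Az).
by split; apply: weval_W_congr Ww _ => j /=; case: eqP => // ->.
Qed.
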